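(* Let $d\ge2$ be an integer and $c\in\mathbb{C}$ such that $f(x)=x^d+c$ is not linearly conjugate to $x^d$ or to $\pm T_d(x)$ (equivalently $c\neq0$, and $c\neq-2$ if $d=2$). For each positive divisor $\delta$ of $d$ let $f_\delta(x)=(x^\delta+c)^{d/\delta}$. Fix a positive integer $n$. Then every pair of non-constant polynomials $A,B\in\mathbb{C}[x]$ with $f^n\circ A=A\circ B$ has the form $A=f^m\circ(x^\delta+c)\circ L$ and $B=L^{-1}\circ f_\delta^n\circ L$ for some integer $m\ge0$, some positive divisor $\delta$ of $d$, and some linear polynomial $L$.
   Context: $T_d$ is the Chebyshev polynomial of degree $d$ ($T_d(z+1/z)=z^d+1/z^d$). Polynomials $f,g$ are linearly conjugate if $f=\eta^{-1}\circ g\circ\eta$ for a linear polynomial $\eta$. $f^m$ denotes the $m$-th iterate, $f^0=\mathrm{id}$. *)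

(* Defs.v *)
(* The complex numbers are R[i] = complex R for R : realType
   (a realType is the real numbers, up to isomorphism). *)
From HB Require Import structures.
From mathcomp Require Import all_boot all_order all_algebra.
From mathcomp Require Import reals.
From mathcomp Require Export complex.
Set Implicit Arguments. Unset Strict Implicit. Unset Printing Implicit Defensive.
Import Order.TTheory GRing.Theory Num.Theory.
Local Open Scope ring_scope.

Definition piter (F : nzRingType) (f : {poly F}) (m : nat) : {poly F} :=
  iter m (fun p => f \Po p) 'X.

Definition is_linear_poly (F : nzRingType) (L : {poly F}) : Prop := size L = 2%N.

Definition lin_inv (F : fieldType) (L : {poly F}) : {poly F} :=
  (lead_coef L)^-1 *: ('X - (L`_0)%:P).

Definition lin_conj (F : fieldType) (f g : {poly F}) : Prop :=
  exists eta : {poly F}, is_linear_poly eta /\ f = lin_inv eta \Po (g \Po eta).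

(* Chebyshev polynomials normalized by T_d(z + 1/z) = z^d + z^-d:
   T_0 = 2, T_1 = X, T_{n+1} = X T_n - T_{n-1}. *)
Fixpoint cheb_pair (F : nzRingType) (n : nat) : {poly F} * {poly F} :=
  match n with
  | 0%N => (2%:P, 'X)
  | n'.+1 => let pr := cheb_pair F n' in (pr.2, 'X * pr.2 - pr.1)
  end.
Definition chebT (F : nzRingType) (n : nat) : {poly F} := (cheb_pair F n).1.

(* Main.v *)
(** Write f = x^d + c.  If f^n o A = A o B then A o B - c is a d-th power.  A
polynomial B cannot have two distinct values at which B - a is a proper power, so
A - c = (x - a)^e H^d with e < d, and B - a = P^p with p = d / gcd(d, e).  If e = 0
then A = f o H and H is again semiconjugate to B, so we descend on the degree.
Otherwise put A1 = x^(e/gcd(d,e)) H(x^p + a); then f o A1 = A o (x^p + a), and A1 is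
itself a solution, of the equation with B1 = P o (x^p + a).  Now A1 is equivariant
under rotation by p-th roots of unity, and A1 - c has the shape found for A - c, so
A1 is highly ramified both over c and over a rotate of c.  Counting zeros of A1'
forces A1 to be linear, hence A = k (x - a)^e + c with e dividing d, unless d = 2 and
A1 is a Chebyshev polynomial up to scaling; in that case, lifting once more forces
c = -2. *)
Require Import Defs.
From HB Require Import structures.
From mathcomp Require Import all_boot all_order all_algebra.
From mathcomp Require Import reals complex.
From mathcomp Require Import zify ring.
Import Order.TTheory GRing.Theory Num.Theory.
Local Open Scope ring_scope.

(** * Quotients by a greatest common divisor *)

Lemma coprime_div_gcd (d m : nat) :
  (0 < d)%N -> coprime (d %/ gcdn d m) (m %/ gcdn d m).
Proof.
move=> d0; have gd : (0 < gcdn d m)%N by rewrite gcdn_gt0 d0.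
rewrite /coprime -(eqn_pmul2r gd) muln_gcdl mul1n.
by rewrite (divnK (dvdn_gcdl d m)) (divnK (dvdn_gcdr d m)).
Qed.

Lemma dvdn_div_gcd (d m k : nat) :
  (0 < d)%N -> (d %| m * k)%N -> (d %/ gcdn d m %| k)%N.
Proof.
move=> d0; have gd : (0 < gcdn d m)%N by rewrite gcdn_gt0 d0.
have e1 := divnK (dvdn_gcdl d m); have e2 := divnK (dvdn_gcdr d m).
rewrite -[X in (X %| _ * _)%N]e1 -[X in (_ %| X * _)%N]e2 mulnAC dvdn_pmul2r //.
by rewrite Gauss_dvdr ?coprime_div_gcd.
Qed.

Section ClosedField.

Set Implicit Arguments.
Unset Strict Implicit.

Variable F : numClosedFieldType.
Implicit Types (A B G H P Q f g : {poly F}) (a b c x z : F) (d e k m n : nat).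

(** * Root multiplicities and perfect powers of polynomials *)

Lemma mup_split x g : g != 0 ->
  exists2 q, ~~ root q x & g = q * ('X - x%:P) ^+ mup x g.
Proof.
move=> g0; have [m [q]] := multiplicity_XsubC g x; rewrite g0 /= => qx def_g.
by exists q; rewrite // {2}def_g mupMr // mup_XsubCX eqxx.
Qed.

Lemma mup_exp x Q k : Q != 0 -> mup x (Q ^+ k) = (k * mup x Q)%N.
Proof.
move=> Q0; elim: k => [|k IH]; first by rewrite expr0 mupNroot ?root1.
by rewrite exprS mupM ?expf_neq0 // IH mulSn.
Qed.

Lemma size_subC B a : (1 < size B)%N -> size (B - a%:P) = size B.
Proof.
by move=> sB; rewrite size_polyDl // size_polyN (leq_ltn_trans (size_polyC_leq1 a)).
Qed.

(** Split off from [g] its full power of [X - B(x)]: the cofactor composed with [B] does not vanish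
    at [x], so only the power of [B - B(x)] contributes. *)
Lemma mup_comp x g B : g != 0 -> (1 < size B)%N ->
  mup x (g \Po B) = (mup B.[x] g * mup x (B - (B.[x])%:P))%N.
Proof.
move=> g0 sB; have [q qr {1}->] := mup_split B.[x] g0.
rewrite comp_polyM rmorphXn /= comp_polyB comp_polyX comp_polyC mupMr; last first.
  by rewrite /root horner_comp.
by rewrite mup_exp // -size_poly_gt0 size_subC // ltnW.
Qed.

(** The root is built from the distinct zeros of [Q], with multiplicities divided by [k], and a
    [k]-th root of the leading coefficient. *)
Lemma expp_of_mup k Q : (0 < k)%N -> (forall x, (k %| mup x Q)%N) -> exists P, Q = P ^+ k.
Proof.
move=> k0; have [->|Q0] := eqVneq Q 0; first by exists 0; rewrite expr0n eqn0Ngt k0.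
have [r def_Q] := closed_field_poly_normal Q => kQ.
have lQ0 : lead_coef Q != 0 by rewrite lead_coef_eq0.
have cQ x : mup x Q = count_mem x r.
  by rewrite def_Q -mul_polyC mupMr ?mu_prod_XsubC // rootC.
exists ((k.-root (lead_coef Q)) *: \prod_(z <- undup r) ('X - z%:P) ^+ (mup z Q %/ k)).
rewrite exprZn rootCK // {1}def_Q -prodr_undup_exp_count; congr (_ *: _).
by rewrite -prodrXl; apply: eq_bigr => z _; rewrite -exprM divnK // cQ.
Qed.

Lemma unity_root_neq0 k z : (0 < k)%N -> z ^+ k = 1 -> z != 0.
Proof.
by move=> k0; apply: contra_eq_neq => ->; rewrite expr0n eqn0Ngt k0 eq_sym oner_eq0.
Qed.

(** Equal powers make [P] and [Q] divide each other, so they are proportional, with ratio that of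
    the leading coefficients. *)
Lemma expp_inj_up_to_unity k P Q : (0 < k)%N -> P ^+ k = Q ^+ k ->
  exists2 z, z ^+ k = 1 & P = z *: Q.
Proof.
move=> k0 ePQ; have [Q0|Q0] := eqVneq Q 0.
  move: ePQ; rewrite Q0 expr0n eqn0Ngt k0 /= => /eqP; rewrite expf_eq0 k0 => /eqP->.
  by exists 1; rewrite ?expr1n ?scaler0.
have /eqpfP e : P %= Q by rewrite /eqp -(dvdp_pexp2r P Q k0) -(dvdp_pexp2r Q P k0) ePQ dvdpp.
have l0 : lead_coef Q != 0 by rewrite lead_coef_eq0.
exists (lead_coef P / lead_coef Q).
  by rewrite expr_div_n -!lead_coef_exp ePQ divff // lead_coef_exp expf_neq0.
exact: e.
Qed.

(** * Coprime divisors of a derivative *)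

Lemma no_common_root_coprimep P Q :
  P != 0 -> (forall x, root P x -> root Q x -> False) -> coprimep P Q.
Proof.
move=> P0 nPQ; rewrite /coprimep; apply: negbNE; apply/negP => /closed_rootP [x].
by rewrite root_gcd => /andP[Px Qx]; apply: (nPQ x).
Qed.

Lemma deriv_neq0 A : (1 < size A)%N -> A^`() != 0.
Proof.
move=> sA; have lA : lead_coef A != 0 by rewrite lead_coef_eq0 -size_poly_gt0 ltnW.
apply/eqP => /(congr1 (fun p : {poly F} => p`_(size A).-2)).
rewrite coef0 coef_deriv; have -> : (size A).-2.+1 = (size A).-1 by lia.
move/eqP; rewrite mulrn_eq0 -/(lead_coef A) (negPf lA) orbF.
by case: (size A) sA => [|[]].
Qed.

Lemma exp_dvdp_deriv P k : P ^+ k.-1 %| (P ^+ k)^`().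
Proof. by rewrite deriv_exp -mulr_natl mulrA dvdp_mulIr. Qed.

Lemma deriv_subC A c : (A - c%:P)^`() = A^`().
Proof. by rewrite derivB derivC subr0. Qed.

Lemma coprimep_dvdp_deriv A P Q : (1 < size A)%N -> coprimep P Q ->
  P %| A^`() -> Q %| A^`() -> ((size P).-1 + (size Q).-1 < (size A).-1)%N.
Proof.
move=> sA cPQ dP dQ; have A'0 := deriv_neq0 sA.
have dPQ : P * Q %| A^`() by rewrite Gauss_dvdp // dP.
have P0 : P != 0 by apply: contraTneq dP => ->; rewrite dvd0p.
have Q0 : Q != 0 by apply: contraTneq dQ => ->; rewrite dvd0p.
have A0 : A != 0 by rewrite -size_poly_gt0 ltnW.
have sP : (0 < size P)%N by rewrite size_poly_gt0.
have sQ : (0 < size Q)%N by rewrite size_poly_gt0.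
have sPQ : size (P * Q) = (size P + size Q).-1 := size_mul P0 Q0.
have le : (size (P * Q)%R <= size A^`())%N := dvdp_leq A'0 dPQ.
have lt : (size A^`() < size A)%N := lt_size_deriv A0.
lia.
Qed.

(* Otherwise P^(j-1) and Q^(k-1) would be coprime divisors of B', of total degree
   at least deg B. *)
Lemma subC_powers_unique B P Q a b j k : (1 < size B)%N -> (1 < j)%N -> (1 < k)%N ->
  B - a%:P = P ^+ j -> B - b%:P = Q ^+ k -> a = b.
Proof.
move=> sB j1 k1 BP BQ; apply/eqP; apply: contraT => ab.
have sP : (size B).-1 = ((size P).-1 * j)%N by rewrite -size_exp -BP size_subC.
have sQ : (size B).-1 = ((size Q).-1 * k)%N by rewrite -size_exp -BQ size_subC.
have P0 : P != 0 by apply/eqP => P0; move: sP; rewrite P0 size_poly0 mul0n; lia.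
suff cPQ : coprimep (P ^+ j.-1) (Q ^+ k.-1).
  have : ((size (P ^+ j.-1)).-1 + (size (Q ^+ k.-1)).-1 < (size B).-1)%N.
    apply: coprimep_dvdp_deriv => //.
      by rewrite -(deriv_subC B a) BP exp_dvdp_deriv.
    by rewrite -(deriv_subC B b) BQ exp_dvdp_deriv.
  (* For degrees [u], [v] of [P], [Q], both [u (j-1)] and [v (k-1)] are at least half of
     [N = u j = v k]. *)
  rewrite !size_exp; move: (size B).-1 sP sQ => N.
  move: ((size P).-1) ((size Q).-1); case: j j1 {BP cPQ} => [|[|?]] // _.
  by case: k k1 {BQ} => [|[|?]] // _ u v; nia.
apply: coprimep_expl; apply: coprimep_expr; apply: no_common_root_coprimep => // x.
move=> /rootP Px /rootP Qx.
have := congr1 (horner^~ x) BP; have := congr1 (horner^~ x) BQ.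
rewrite !hornerE Px Qx !expr0n !eqn0Ngt (ltnW j1) (ltnW k1) /=.
by move=> /subr0_eq eb /subr0_eq ea; move: ab; rewrite -ea -eb eqxx.
Qed.

(** * Compositions that are a power plus a constant *)

(** By [mup_comp], [d] divides the order of [g] at [B(x)] times that of [B - B(x)] at [x]. So
    [B - a] is a power of exponent [d / gcd(d, mup a g)] for every [a]. By [subC_powers_unique] this
    exponent exceeds 1 for at most one [a]; elsewhere [d] divides the multiplicities of [g]. *)
Lemma comp_sub_const_power A B G c d : (0 < d)%N ->
  (1 < size A)%N -> (1 < size B)%N -> (A \Po B) - c%:P = G ^+ d ->
  exists a e H P, [/\ (e < d)%N, A - c%:P = ('X - a%:P) ^+ e * H ^+ d
    & B - a%:P = P ^+ (d %/ gcdn d e)].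
Proof.
move=> d0 sA sB AB; set g := A - c%:P.
have g0 : g != 0 by rewrite -size_poly_gt0 size_subC //; lia.
have gB : g \Po B = G ^+ d by rewrite comp_polyB comp_polyC.
have G0 : G != 0.
  by move: g0; rewrite -(comp_poly_eq0 g sB) gB expf_eq0 d0.
have dmup x : (d %| mup B.[x] g * mup x (B - (B.[x])%:P))%N.
  by rewrite -mup_comp // gB mup_exp // dvdn_mulr.
have pw a : exists P, B - a%:P = P ^+ (d %/ gcdn d (mup a g)).
  have gd : (0 < gcdn d (mup a g))%N by rewrite gcdn_gt0 d0.
  apply: expp_of_mup; first by rewrite divn_gt0 // dvdn_leq // dvdn_gcdl.
  move=> x; have [<-|nax] := eqVneq B.[x] a; last first.
    by rewrite (@mupNroot _ x) ?dvdn0 // rootE hornerD hornerN hornerC subr_eq0.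
  exact: dvdn_div_gcd d0 (dmup x).
have pgt1 a : ~~ (d %| mup a g)%N -> (1 < d %/ gcdn d (mup a g))%N.
  move=> nd; rewrite ltn_neqAle divn_gt0 ?gcdn_gt0 ?d0 // dvdn_leq ?dvdn_gcdl // andbT.
  apply: contra nd => /eqP e.
  by rewrite -[X in (X %| _)%N](divnK (dvdn_gcdl d (mup a g))) -e mul1n dvdn_gcdr.
have [|nall] := boolP (all (fun a => d %| mup a g)%N (sval (closed_field_poly_normal g))).
  move/allP=> h; have [|H ->] := @expp_of_mup d g d0; last first.
    (* With [e = 0] the point [a] is arbitrary and the exponent [d / gcd(d, 0)] is 1. *)
    exists 0, 0%N, H, (B - 0%:P); split=> //; first by rewrite expr0 mul1r.
    by rewrite gcdn0 divnn d0.
  move=> x; have [xr|xr] := boolP (root g x); last by rewrite mupNroot.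
  apply: h; case: closed_field_poly_normal => r /= eg.
  by move: xr; rewrite eg rootZ ?root_prod_XsubC ?lead_coef_eq0.
have [a _ nda] := allPn nall.
(* Whole [d]-th powers of [X - a] go into [H]; reducing the exponent mod [d] keeps its gcd with
   [d]. *)
exists a, (mup a g %% d)%N.
have [q qa eg] := mup_split a g0.
have [H eH] : exists H, q = H ^+ d.
  apply: expp_of_mup => // x; have [->|xa] := eqVneq x a; first by rewrite mupNroot.
  have -> : mup x q = mup x g.
    by rewrite eg mupMl // rootE horner_exp hornerXsubC expf_neq0 ?subr_eq0.
  apply: contraT => ndx; have [P hP] := pw a; have [Q hQ] := pw x.
  by rewrite (subC_powers_unique sB (pgt1 _ nda) (pgt1 _ ndx) hP hQ) eqxx in xa.
have [P hP] := pw a.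
exists (H * ('X - a%:P) ^+ (mup a g %/ d)), P; split.
- by rewrite ltn_mod.
- rewrite exprMn -exprM mulrCA -exprD -eH {1}eg {1}(divn_eq (mup a g) d).
  by congr (_ * _ ^+ _); rewrite addnC.
- by rewrite gcdn_modr.
Qed.

(** * Iterates of [x^d + c] and lifts through [x^p + a] *)

Lemma size_mul_pred P Q : P != 0 -> Q != 0 ->
  (size (P * Q)).-1 = ((size P).-1 + (size Q).-1)%N.
Proof.
move=> P0 Q0; rewrite size_mul //; move: P0 Q0; rewrite -!size_poly_gt0.
by case: (size P) (size Q) => [|p] [|q] //= _ _; rewrite addnS.
Qed.

Lemma unicritical_comp d c P : ('X^d + c%:P) \Po P = P ^+ d + c%:P.
Proof. by rewrite comp_polyD comp_polyC comp_Xn_poly. Qed.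

Lemma piterS f n : piter f n.+1 = f \Po piter f n.
Proof. by []. Qed.

Lemma piterSr f n : piter f n.+1 = piter f n \Po f.
Proof.
elim: n => [|n IH]; first by rewrite piterS comp_polyXr comp_polyX.
by rewrite piterS {1}IH comp_polyA -piterS.
Qed.

Lemma size_XnaddC k a : (0 < k)%N -> size ('X^k + a%:P) = k.+1.
Proof.
by move=> k0; rewrite size_polyDl size_polyXn // (leq_ltn_trans (size_polyC_leq1 a)).
Qed.

(** The innermost copy of [f] absorbs the scalar, whence [0 < n]. *)
Lemma piter_compZ f n P z : (0 < n)%N -> f \Po (z *: P) = f \Po P ->
  piter f n \Po (z *: P) = piter f n \Po P.
Proof. by case: n => // n _ fz; rewrite piterSr -!comp_polyA fz. Qed.

(* If A - c = (x - a)^e H^d and p = d / gcd(d, e), this is a d-th root of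
   (A - c) o (x^p + a). *)
Definition root_lift d a e H : {poly F} :=
  'X^(e %/ gcdn d e) * (H \Po ('X^(d %/ gcdn d e) + a%:P)).

Lemma root_lift_exp d a e H :
  root_lift d a e H ^+ d =
  (('X - a%:P) ^+ e * H ^+ d) \Po ('X^(d %/ gcdn d e) + a%:P).
Proof.
rewrite /root_lift exprMn -exprM comp_polyM !rmorphXn /= comp_polyB comp_polyX comp_polyC.
rewrite addrK -exprM.
have -> // : (e %/ gcdn d e * d = d %/ gcdn d e * e)%N.
by rewrite mulnC muln_divCA_gcd mulnC.
Qed.

Lemma root_liftZ d a e H z : root_lift d a e (z *: H) = z *: root_lift d a e H.
Proof. by rewrite /root_lift comp_polyZ scalerAr. Qed.

Lemma size_root_lift d a e H : H != 0 -> (0 < d)%N ->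
  (size (root_lift d a e H)).-1 = (e %/ gcdn d e + (size H).-1 * (d %/ gcdn d e))%N.
Proof.
move=> H0 d0; set p := (d %/ _)%N.
have p0 : (0 < p)%N by rewrite divn_gt0 ?gcdn_gt0 ?d0 // dvdn_leq ?dvdn_gcdl.
have sX : size ('X^p + a%:P) = p.+1 := size_XnaddC a p0.
have HX0 : H \Po ('X^p + a%:P) != 0 by rewrite comp_poly_eq0 // sX.
by rewrite size_mul_pred ?expf_neq0 ?polyX_eq0 // size_polyXn size_comp_poly sX.
Qed.

Lemma root_lift_rotate d a e H w : w ^+ (d %/ gcdn d e) = 1 ->
  root_lift d a e H \Po (w *: 'X) = w ^+ (e %/ gcdn d e) *: root_lift d a e H.
Proof.
move=> w1; rewrite /root_lift comp_polyM comp_Xn_poly exprZn -comp_polyA.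
by rewrite unicritical_comp exprZn w1 scale1r scalerAl.
Qed.

(** Data extracted from [f^(n+1) o A = A o B]. The last clause normalizes [H], which the second
    determines only up to a [d]-th root of unity. *)
Definition factored d c n A B a e H P : Prop :=
  [/\ (e < d)%N, A - c%:P = ('X - a%:P) ^+ e * H ^+ d,
    B - a%:P = P ^+ (d %/ gcdn d e)
    & root_lift d a e H \Po P = piter ('X^d + c%:P) n \Po A].

Lemma semiconj_factor d c n A B : (0 < d)%N -> (1 < size A)%N -> (1 < size B)%N ->
  piter ('X^d + c%:P) n.+1 \Po A = A \Po B ->
  exists a e H P, factored d c n A B a e H P.
Proof.
move=> d0 sA sB; rewrite piterS -comp_polyA unicritical_comp => fAB.
set G := piter _ n \Po A in fAB *.
have AB : (A \Po B) - c%:P = G ^+ d by rewrite -fAB addrK.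
have [a [e [H [P [ed eA eB]]]]] := comp_sub_const_power d0 sA sB AB.
have : (root_lift d a e H \Po P) ^+ d = G ^+ d.
  rewrite -rmorphXn /= root_lift_exp -eA -comp_polyA unicritical_comp -eB subrK.
  by rewrite comp_polyB comp_polyC.
case/(expp_inj_up_to_unity d0) => z z1 ez.
have z0 := unity_root_neq0 d0 z1.
(* The lift is linear in [H], so rescaling [H] removes the root of unity [z] without changing
   [H^d]. *)
exists a, e, (z^-1 *: H), P; split=> //.
  by rewrite exprZn exprVn z1 invr1 scale1r.
by rewrite root_liftZ comp_polyZ ez scalerA mulVf // scale1r.
Qed.

Lemma unicritical_root_lift d c a e H A :
  A - c%:P = ('X - a%:P) ^+ e * H ^+ d ->
  ('X^d + c%:P) \Po root_lift d a e H = A \Po ('X^(d %/ gcdn d e) + a%:P).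
Proof.
move=> eA; rewrite unicritical_comp root_lift_exp -eA comp_polyB comp_polyC.
by rewrite subrK.
Qed.

Lemma semiconj_root_lift d c n A a e H P :
  A - c%:P = ('X - a%:P) ^+ e * H ^+ d ->
  root_lift d a e H \Po P = piter ('X^d + c%:P) n \Po A ->
  piter ('X^d + c%:P) n.+1 \Po root_lift d a e H =
  root_lift d a e H \Po (P \Po ('X^(d %/ gcdn d e) + a%:P)).
Proof.
move=> eA eP.
by rewrite comp_polyA eP piterSr -!comp_polyA (unicritical_root_lift eA).
Qed.

(** * Rotational symmetry and critical values of the lift *)

(** Any root of [1 + x + ... + x^(k-1)] works: at 1 this sum is [k], nonzero in characteristic 0. *)
Lemma exists_nontrivial_unity_root k : (1 < k)%N -> exists2 w : F, w ^+ k = 1 & w != 1.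
Proof.
move=> k1; have [|w] := closed_rootP (\poly_(i < k) (1 : F)) _.
  by rewrite size_poly_eq ?oner_eq0 // gtn_eqF.
rewrite rootE horner_poly => /eqP s0.
have w1 : w ^+ k = 1.
  apply/eqP; rewrite -subr_eq0 subrX1 (_ : \sum_(i < k) _ = 0) ?mulr0 //.
  by rewrite -[RHS]s0; apply: eq_bigr => i _; rewrite mul1r.
exists w => //; apply/eqP => ew; move: s0; rewrite ew.
under eq_bigr do rewrite expr1n mulr1.
by rewrite sumr_const card_ord => /eqP; rewrite pnatr_eq0; case: k k1 {w1}.
Qed.

Lemma size_monomial_power A c a e H d : (0 < d)%N -> (1 < size A)%N ->
  A - c%:P = ('X - a%:P) ^+ e * H ^+ d ->
  H != 0 /\ (size A).-1 = (e + (size H).-1 * d)%N.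
Proof.
move=> d0 sA eA; have H0 : H != 0.
  apply: contraTneq sA => H0; move: eA; rewrite H0 expr0n eqn0Ngt d0 mulr0.
  by move=> /subr0_eq ->; rewrite -leqNgt size_polyC_leq1.
split=> //; rewrite -(size_subC c sA) eA size_mul_pred ?expf_neq0 ?polyXsubC_eq0 //.
by rewrite size_exp_XsubC -size_exp.
Qed.

(* U = (x - a)^(e-1) H^(d-1) and its rotation V = U(w x) both divide A', and they
   are coprime because A takes the values c and c/z on their roots; comparing
   degrees leaves only the two cases. *)
Lemma rotation_critical_values A a c d e H w z :
  (1 < d)%N -> (1 < size A)%N -> c != 0 -> w != 0 -> z != 1 -> z != 0 ->
  A \Po (w *: 'X) = z *: A -> A - c%:P = ('X - a%:P) ^+ e * H ^+ d ->
  size A = 2%N \/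
  [/\ d = 2%N, e = 1%N, (1 < size H)%N
    & forall x, root A^`() x -> A.[x] = c \/ z * A.[x] = c].
Proof.
move=> d1 sA c0 w0 z1 z0 rotA eA; have d0 := ltnW d1.
have [H0 dA] := size_monomial_power d0 sA eA.
pose U : {poly F} := ('X - a%:P) ^+ e.-1 * H ^+ d.-1; pose V : {poly F} := U \Po (w *: 'X).
have sw : size (w *: 'X : {poly F}) = 2%N by rewrite size_scale // size_polyX.
have U0 : U != 0 by rewrite mulf_neq0 ?expf_neq0 ?polyXsubC_eq0.
have V0 : V != 0 by rewrite comp_poly2_eq0.
have UA : U %| A^`().
  rewrite -(deriv_subC A c) eA derivM; apply: dvdp_add.
    by apply: dvdp_mul; [exact: exp_dvdp_deriv | exact/dvdp_exp2l/leq_pred].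
  by apply: dvdp_mul; [exact/dvdp_exp2l/leq_pred | exact: exp_dvdp_deriv].
have VA : V %| A^`().
  have : V %| (A \Po (w *: 'X))^`() by rewrite deriv_comp dvdp_mulr // dvdp_comp_poly.
  by rewrite rotA derivZ dvdpZr.
have /dvdpP[q eq] : U %| A - c%:P by rewrite eA dvdp_mul // dvdp_exp2l ?leq_pred.
have Uc x : root U x -> A.[x] = c.
  move=> /rootP Ux; apply: subr0_eq; move: (congr1 (horner^~ x) eq).
  by rewrite hornerM Ux mulr0 hornerD hornerN hornerC.
have Vc x : root V x -> z * A.[x] = c.
  by rewrite rootE horner_comp -rootE => /Uc; rewrite -horner_comp rotA hornerZ.
have cUV : coprimep U V.
  apply: no_common_root_coprimep => // x /Uc Ax /Vc; rewrite Ax => /eqP.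
  by rewrite -{2}[c]mul1r (inj_eq (mulIf c0)) (negPf z1).
have lt : ((size U).-1 + (size V).-1 < (size A).-1)%N by exact: coprimep_dvdp_deriv.
have sU : (size U).-1 = (e.-1 + (size H).-1 * d.-1)%N.
  by rewrite size_mul_pred ?expf_neq0 ?polyXsubC_eq0 // size_exp_XsubC -size_exp.
have sV : size V = size U := size_comp_poly2 _ sw.
have sH : (0 < size H)%N by rewrite size_poly_gt0.
have [sA2|sA2] := eqVneq (size A) 2%N; [by left | right].
(* With [h = deg H], the degree bound reads [e + h (d-2) < 2] if [e > 0], and is impossible if
   [e = 0]. *)
have [d2 e1 sH1] : [/\ d = 2, e = 1 & 1 < size H]%N.
  move: lt dA; rewrite sV sU; move: (size H) sH (size A) sA sA2 => h h0 s s1 s2.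
  move: d1; case: d {U U0 V V0 UA VA cUV sU sV d0 eA q eq Uc Vc} => [|[|d]] // _.
  case: h h0 => // h _; case: e => [|e] /=; [nia |].
  by move=> *; split; nia.
split=> // x; have A'0 := deriv_neq0 sA.
(* Now [deg U = deg V = deg H] and [deg A' = 2 deg H], so [U V] accounts for every critical
   point. *)
have UVA : A^`() %= U * V.
  have A0 : A != 0 by rewrite -size_poly_gt0 ltnW.
  have lt2 : (size A^`() < size A)%N := lt_size_deriv A0.
  have dUV : U * V %| A^`() by rewrite Gauss_dvdp ?UA.
  have le2 : ((size U + size V).-1 <= size A^`())%N by rewrite -size_mul // dvdp_leq.
  have sU0 : (0 < size U)%N by rewrite size_poly_gt0.
  have eUV : (size U + size V).-1 = size A^`() by move: dA sU sV; rewrite d2 e1; lia.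
  by rewrite eqp_sym -dvdp_size_eqp // size_mul // eUV.
by rewrite (eqp_root UVA) rootM => /orP[/Uc|/Vc]; [left | right].
Qed.

Lemma factored_root_lift d c n A B a e H P :
  (1 < size A)%N -> (1 < size B)%N -> (0 < e)%N ->
  factored d c n A B a e H P ->
  exists B1, [/\ (1 < size (root_lift d a e H))%N, (1 < size B1)%N
    & piter ('X^d + c%:P) n.+1 \Po root_lift d a e H = root_lift d a e H \Po B1].
Proof.
move=> sA sB e0 [ed eA eB eP]; have d0 : (0 < d)%N by apply: leq_ltn_trans ed.
set p := (d %/ gcdn d e)%N in eB *.
have p0 : (0 < p)%N by rewrite divn_gt0 ?gcdn_gt0 ?d0 // dvdn_leq ?dvdn_gcdl.
exists (P \Po ('X^p + a%:P)); split; last exact: semiconj_root_lift eA eP.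
  have [H0 _] := size_monomial_power d0 sA eA.
  suff : (0 < (size (root_lift d a e H)).-1)%N by case: (size _) => [|[]].
  rewrite size_root_lift // addn_gt0 divn_gt0 ?gcdn_gt0 ?d0 //.
  by rewrite dvdn_leq ?dvdn_gcdr.
have sP : (size B).-1 = ((size P).-1 * p)%N by rewrite -size_exp -eB size_subC.
suff : (0 < (size (P \Po ('X^p + a%:P))).-1)%N by case: (size _) => [|[]].
rewrite size_comp_poly size_XnaddC // -sP.
by case: (size B) sB => [|[]].
Qed.

(** The lift solves an equation of the same kind, so it factors in turn; as [0 < e < d], it also has
    a nontrivial rotational symmetry, and [rotation_critical_values] applies. *)
Lemma root_lift_dichotomy d c n A B a e H P :
  (1 < d)%N -> c != 0 -> (1 < size A)%N -> (1 < size B)%N -> (0 < e)%N ->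
  factored d c n A B a e H P ->
  let A1 := root_lift d a e H in
  size A1 = 2%N \/
  d = 2%N /\ exists a1 H1 P1 B1,
   [/\ (1 < size A1)%N && (1 < size B1)%N, factored d c n A1 B1 a1 1 H1 P1,
    (1 < size H1)%N, A1 \Po (- 'X) = - A1
    & forall x, root A1^`() x -> A1.[x] = c \/ A1.[x] = - c].
Proof.
move=> d1 c0 sA sB e0 hA A1; have d0 := ltnW d1.
have [B1 [sA1 sB1 fA1]] := factored_root_lift sA sB e0 hA.
have [a1 [e1 [H1 [P1 hA1]]]] := semiconj_factor d0 sA1 sB1 fA1.
have [ed _ _ _] := hA; set g := gcdn d e.
have g0 : (0 < g)%N by rewrite gcdn_gt0 d0.
have p1 : (1 < d %/ g)%N.
  by rewrite ltn_divRL ?dvdn_gcdl // mul1n (leq_ltn_trans _ ed) // dvdn_leq ?dvdn_gcdr.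
have [w wp w1] := exists_nontrivial_unity_root p1.
have w0 := unity_root_neq0 (ltnW p1) wp.
set z := w ^+ (e %/ g); have z0 : z != 0 by rewrite expf_neq0.
(* If [z = 1], the order of [w] would divide the coprime numbers [d / g] and [e / g]. *)
have z1 : z != 1.
  have [m pm mp] := prim_order_exists (ltnW p1) wp.
  apply: contra w1 => ze; rewrite -[w]expr1 -(prim_order_dvd pm).
  rewrite -(eqP (coprime_div_gcd d e d0)) dvdn_gcd mp /=.
  by rewrite (prim_order_dvd pm).
have rotA : A1 \Po (w *: 'X) = z *: A1 by apply: root_lift_rotate.
have [_ eA1 _ _] := hA1.
have [|[d2 e11 sH1 crit]] := rotation_critical_values d1 sA1 c0 w0 z1 z0 rotA eA1.
  by left.
right; split=> //; exists a1, H1, P1, B1; rewrite e11 in hA1.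
have wd : w ^+ d = 1 by rewrite -(divnK (dvdn_gcdl d e)) exprM wp expr1n.
have wN : w = -1.
  by move: wd; rewrite d2 => /eqP; rewrite sqrf_eq1 (negPf w1) => /eqP.
have zN : z = -1.
  have /eqP : z ^+ 2 = 1 by rewrite -d2 -exprM mulnC exprM wd expr1n.
  by rewrite sqrf_eq1 (negPf z1) => /eqP.
split=> //; first exact/andP.
  by move: rotA; rewrite wN zN !scaleN1r.
move=> x /crit; rewrite zN mulN1r => -[->|<-]; [by left | by right; rewrite opprK].
Qed.

(* In the quadratic exceptional case the next lift A2 is odd with critical values
   +-c, while A1 has the critical value -c; comparing critical values in
   f o A2 = A1 o (x^2 + a1) gives c^2 + c = -c. *)
Lemma root_lift_linear d c n A B a e H P :
  (1 < d)%N -> c != 0 -> (d = 2%N -> c != - 2%:R) ->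
  (1 < size A)%N -> (1 < size B)%N -> (0 < e)%N ->
  factored d c n A B a e H P -> size (root_lift d a e H) = 2%N.
Proof.
move=> d1 c0 c2 sA sB e0 hA.
have [//|[d2]] := root_lift_dichotomy d1 c0 sA sB e0 hA; subst d.
move=> [a1 [H1 [P1 [B1 [/andP[sA1 sB1] hA1 sH1 oddA1 _]]]]].
set A1 := root_lift 2 a e H in sA1 hA1 oddA1 *.
have [_ eA1 _ _] := hA1.
have [H10 _] := size_monomial_power (ltnW d1) sA1 eA1.
(* The second lift has degree [1 + 2 deg H1], at least 3, so it is not linear. *)
have [sA2|[_]] := root_lift_dichotomy d1 c0 sA1 sB1 (ltn0Sn 0) hA1.
  have := size_root_lift a1 1 H10 (ltnW d1); rewrite sA2.
  by case: (size H1) sH1 => [|[]].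
move=> [_ [_ [_ [_ [_ _ _ _ crit]]]]].
(* A root [r] of [H1] is a critical point of [A1] with value [c]; by oddness [-r] is one with value
   [-c]. *)
have /closed_rootP[r /rootP H1r] : size H1 != 1%N by rewrite gtn_eqF.
have A1r : A1.[r] = c.
  apply: subr0_eq; move: (congr1 (horner^~ r) eA1).
  by rewrite hornerM !horner_exp H1r expr0n mulr0 hornerD hornerN hornerC.
have A1'r : (A1^`()).[r] = 0.
  have /dvdpP[q ->] : H1 %| A1^`(); last by rewrite hornerM H1r mulr0.
  rewrite -(deriv_subC A1 c) eA1 derivM dvdp_add // dvdp_mull ?dvdp_exp //.
  exact: (exp_dvdp_deriv H1 2).
have A1Nr : A1.[- r] = - c.
  by rewrite -A1r -hornerN -oddA1 horner_comp !hornerE.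
have A1'Nr : (A1^`()).[- r] = 0.
  have := congr1 deriv oddA1; rewrite deriv_comp !derivN derivX mulrN1 => /oppr_inj oA'.
  by rewrite -A1'r -[in RHS]oA' horner_comp hornerN hornerX.
(* A preimage of [-r] under [x^2 + a1], where the identity [fA2] is evaluated and differentiated. *)
pose x := sqrtC (- r - a1).
have xE : x ^+ 2 + a1 = - r by rewrite sqrtCK subrK.
have := unicritical_root_lift eA1; rewrite (_ : 2 %/ gcdn 2 1 = 2)%N // => fA2.
set A2 := root_lift 2 a1 1 H1 in fA2 crit.
have fA2x : A2.[x] ^+ 2 + c = - c.
  have := congr1 (horner^~ x) fA2; rewrite unicritical_comp hornerD horner_exp.
  by rewrite hornerC horner_comp hornerD hornerXn hornerC xE A1Nr.
have : A2.[x] * (A2^`()).[x] = 0.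
  have qx : ('X^2 + a1%:P).[x] = - r by rewrite hornerD hornerXn hornerC.
  have := congr1 deriv fA2; rewrite unicritical_comp deriv_comp [in LHS]derivD.
  rewrite derivC addr0 deriv_exp expr1 => /(congr1 (horner^~ x)).
  rewrite hornerMn !hornerM horner_comp qx A1'Nr mul0r.
  by move/eqP; rewrite mulrn_eq0 mulrC => /eqP.
(* [A2(x) = 0] would give [c = -c]; otherwise [x] is critical for [A2], so [A2(x)^2 = c^2]. *)
move=> /eqP; rewrite mulf_eq0 => /orP[/eqP A2x|A2'x].
  move: fA2x; rewrite A2x expr0n add0r => /eqP; rewrite -addr_eq0 -mulr2n.
  by rewrite mulrn_eq0 (negPf c0).
have A2c : A2.[x] ^+ 2 = c ^+ 2 by case: (crit x A2'x) => ->; rewrite ?sqrrN.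
have : c * (c + 2%:R) = 0 by rewrite -[RHS](subrr (- c)) -{1}fA2x A2c; ring.
move=> /eqP; rewrite mulf_eq0 (negPf c0) addr_eq0 /= => /eqP cE.
by have := c2 erefl; rewrite cE eqxx.
Qed.

(** * Normal form when the lift is linear *)

Lemma lin_invK L Q : is_linear_poly L -> lin_inv L \Po (L \Po Q) = Q.
Proof.
move=> sL; have l0 : lead_coef L != 0 by rewrite lead_coef_eq0 -size_poly_gt0 sL.
have eL : L - (L`_0)%:P = lead_coef L *: 'X.
  apply/polyP => i; rewrite coefB coefC coefZ coefX lead_coefE sL.
  case: i => [|[|i]] /=; rewrite ?subrr ?mulr0 ?subr0 ?mulr1 //.
  by rewrite nth_default ?sL.
rewrite comp_polyA /lin_inv comp_polyZ comp_polyB comp_polyX comp_polyC eL.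
by rewrite scalerA mulVf // scale1r comp_polyX.
Qed.

(** For one iterate, both sides equal [(x^k + c)^d + c]. *)
Lemma unicritical_piter d k c n : (k %| d)%N ->
  ('X^k + c%:P) \Po piter (('X^k + c%:P) ^+ (d %/ k)) n =
  piter ('X^d + c%:P) n \Po ('X^k + c%:P).
Proof.
move=> kd; elim: n => [|n IH]; first by rewrite /piter /= comp_polyX comp_polyXr.
rewrite !piterS -[RHS]comp_polyA -IH !unicritical_comp rmorphXn /= unicritical_comp.
by rewrite -exprM divnK.
Qed.

(** Cancelling [x^k + c] on the left leaves a [k]-th root of unity [z]. Replacing [L] by [L / z]
    removes it, since [x^k + c] and the iterate absorb such scalars. *)
Lemma semiconj_linear_form d k c n L B : (0 < n)%N -> (0 < k)%N -> (k %| d)%N ->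
  is_linear_poly L ->
  piter ('X^d + c%:P) n \Po (('X^k + c%:P) \Po L) = (('X^k + c%:P) \Po L) \Po B ->
  exists L', [/\ is_linear_poly L', ('X^k + c%:P) \Po L' = ('X^k + c%:P) \Po L
    & B = lin_inv L' \Po (piter (('X^k + c%:P) ^+ (d %/ k)) n \Po L')].
Proof.
move=> n0 k0 kd sL; set h := ('X^k + c%:P) ^+ _.
rewrite comp_polyA -unicritical_piter // -!comp_polyA !unicritical_comp -/h.
move=> /addIr /esym /(expp_inj_up_to_unity k0) [z z1 eB].
have z0 := unity_root_neq0 k0 z1.
have zV1 : z^-1 ^+ k = 1 by rewrite exprVn z1 invr1.
have hz Q : ('X^k + c%:P) \Po (z^-1 *: Q) = ('X^k + c%:P) \Po Q.
  by rewrite !unicritical_comp exprZn zV1 scale1r.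
have sL' : is_linear_poly (z^-1 *: L) by rewrite /is_linear_poly size_scale ?invr_neq0.
exists (z^-1 *: L); split; [exact: sL' | by rewrite hz unicritical_comp | ].
rewrite piter_compZ //; last by rewrite /h !rmorphXn /= hz.
have -> : piter h n \Po L = (z^-1 *: L) \Po B.
  by rewrite comp_polyZ eB scalerA mulVf // scale1r.
by rewrite lin_invK.
Qed.

(** The degree [e/g + (d/g) deg H] is 1 with [e/g > 0], so [e = g] and [H] is a constant, whose
    [d]-th power is absorbed into [L]. *)
Lemma root_lift_linear_form d c A a e H : (0 < d)%N -> (1 < size A)%N -> (0 < e)%N ->
  A - c%:P = ('X - a%:P) ^+ e * H ^+ d -> size (root_lift d a e H) = 2%N ->
  (e %| d)%N /\ exists2 L, is_linear_poly L & A = ('X^e + c%:P) \Po L.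
Proof.
move=> d0 sA e0 eA sl; have [H0 _] := size_monomial_power d0 sA eA.
have := size_root_lift a e H0 d0; rewrite sl; set g := gcdn d e.
have g0 : (0 < g)%N by rewrite gcdn_gt0 d0.
have p0 : (0 < d %/ g)%N by rewrite divn_gt0 // dvdn_leq ?dvdn_gcdl.
have q0 : (0 < e %/ g)%N by rewrite divn_gt0 // dvdn_leq ?dvdn_gcdr.
have sH0 : (0 < size H)%N by rewrite size_poly_gt0.
move=> e1; have [q1 sH] : (e %/ g = 1 /\ size H = 1)%N.
  move: (e %/ g)%N (d %/ g)%N (size H) e1 p0 q0 sH0 => [|q] [|p] [|h] //= e1 _ _ _.
  by split; nia.
have eg : e = g by rewrite -(divnK (dvdn_gcdr d e)) -/g q1 mul1n.
have ed : (e %| d)%N by rewrite eg dvdn_gcdl.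
split=> //; have /size_poly1P[k k0 eH] : size H == 1%N by rewrite sH.
exists (k ^+ (d %/ e) *: ('X - a%:P)).
  by rewrite /is_linear_poly size_scale ?expf_neq0 // size_XsubC.
rewrite unicritical_comp exprZn -exprM divnK // -(subrK c%:P A) eA eH.
by rewrite -polyC_exp mulrC mul_polyC.
Qed.

(** * Descent on the degree of [A] *)

(** Here [m] counts the descents with [e = 0], and [k] is the positive [e] at which they stop. *)
Theorem semiconj_unicritical d c n A B :
  (1 < d)%N -> c != 0 -> (d = 2%N -> c != - 2%:R) -> (0 < n)%N ->
  (1 < size A)%N -> (1 < size B)%N ->
  piter ('X^d + c%:P) n \Po A = A \Po B ->
  exists (m k : nat) (L : {poly F}),
    [/\ (0 < k)%N, (k %| d)%N, is_linear_poly L,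
        A = piter ('X^d + c%:P) m \Po (('X^k + c%:P) \Po L)
      & B = lin_inv L \Po (piter (('X^k + c%:P) ^+ (d %/ k)) n \Po L)].
Proof.
move=> d1 c0 c2 n0 + sB; have d0 := ltnW d1.
have [N] := ubnP (size A); elim: N A => // N IH A leN sA fAB.
case: n n0 fAB IH => // n _ fAB IH.
have [a [e [H [P hA]]]] := semiconj_factor d0 sA sB fAB.
have [ed eA eB eP] := hA.
have [H0 dA] := size_monomial_power d0 sA eA.
case: (posnP e) => [e0|e0].
  move: eA eB eP; rewrite e0 /root_lift gcdn0 divnn d0 div0n !expr1 !expr0 !mul1r.
  move=> eA eB; rewrite -comp_polyA comp_polyD comp_polyX comp_polyC -eB subrK => eP.
  have eAH : A = ('X^d + c%:P) \Po H by rewrite unicritical_comp -eA subrK.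
  have fHB : piter ('X^d + c%:P) n.+1 \Po H = H \Po B.
    by rewrite eP piterSr -comp_polyA -eAH.
  have [||m [k [L [k0 kd sL eH eBL]]]] := IH H _ _ fHB.
  - by move: dA leN; rewrite e0; nia.
  - by move: dA sA; rewrite e0; nia.
  exists m.+1, k, L; split=> //.
  by rewrite eAH eH comp_polyA.
have sl := root_lift_linear d1 c0 c2 sA sB e0 hA.
have [kd [L0 sL0 eAL]] := root_lift_linear_form d0 sA e0 eA sl.
rewrite eAL in fAB.
have [//|L [sL eL eBL]] := semiconj_linear_form _ e0 kd sL0 fAB.
by exists 0%N, e, L; split=> //; rewrite comp_polyX eL.
Qed.

End ClosedField.

Theorem theorem7p1 (R : realType) (d : nat) (c : R[i]) (n : nat)
  (hd : (2 <= d)%N)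
  (hnX : ~ lin_conj ('X^d + c%:P) 'X^d)
  (hnT : ~ lin_conj ('X^d + c%:P) (chebT _ d))
  (hnmT : ~ lin_conj ('X^d + c%:P) (- chebT _ d))
  (hn : (0 < n)%N)
  (A B : {poly R[i]})
  (hA : (1 < size A)%N) (hB : (1 < size B)%N)
  (hAB : piter ('X^d + c%:P) n \Po A = A \Po B) :
  exists (m delta : nat) (L : {poly R[i]}),
    [/\ (0 < delta)%N, (delta %| d)%N, is_linear_poly L,
        A = piter ('X^d + c%:P) m \Po (('X^delta + c%:P) \Po L)
      & B = lin_inv L \Po (piter (('X^delta + c%:P) ^+ (d %/ delta)) n \Po L)].
Proof.
have lin_conj_refl (f : {poly R[i]}) : lin_conj f f.
  have sX : is_linear_poly ('X : {poly R[i]}) by rewrite /is_linear_poly size_polyX.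
  by exists 'X; split=> //; have := lin_invK f sX; rewrite comp_polyX comp_polyXr => ->.
apply: semiconj_unicritical => //.
  by apply/eqP => c0; apply: hnX; rewrite c0 addr0.
(* For [d = 2] and [c = -2], [f] is [T_2 = x^2 - 2] itself. *)
move=> d2; apply/eqP => c2; apply: hnT.
suff <- : 'X^d + c%:P = chebT R[i] d by [].
by rewrite c2 d2 /chebT /= polyCN -expr2.
Qed.
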